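(* Let $f:\mathbb{R}\to\mathbb{R}$ be a concave function, let $a>0$ be a real number and $\mu\ge 1$ an integer, and let $\mathcal{X}_1=\{(w,x)\in\mathbb{R}\times\mathbb{Z} : w\le f(ax),\ 0\le x\le\mu\}$. For any $k\in\{1,\dots,\mu\}$, the inequality $$w\le [f(ka)-f((k-1)a)](x-k)+f(ka)$$ is facet-defining for $\operatorname{conv}(\mathcal{X}_1)$.
   Context: $\operatorname{conv}$ denotes the convex hull. A linear inequality is facet-defining for a polyhedron $P$ if it is valid for $P$ (satisfied by every point of $P$) and the set of points of $P$ satisfying it with equality is a face of dimension $\dim P-1$. *)

(* Defs.v *)
From mathcomp Require Import all_boot all_order all_algebra.
From mathcomp Require Import all_classical all_reals interval_inference.
From mathcomp Require Import convex.

Set Implicit Arguments.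
Unset Strict Implicit.
Unset Printing Implicit Defensive.

Import Order.TTheory GRing.Theory Num.Theory.

Local Open Scope classical_set_scope.
Local Open Scope convex_scope.
Local Open Scope ring_scope.

(* Mirrors [convex_function], with the inequality reversed. *)
Definition concave_function (R : numFieldType) (E : lmodType R)
    (E' := convex_lmodType E) (D : set E') (f : E' -> R^o) : Prop :=
  forall t : {i01 R},
    {in D &, forall x y : E', f x <| t |> f y <= f (x <| t |> y)}.

Definition convex_hull (R : numDomainType) (M : lmodType R) (S : set M) :
    set M :=
  smallest (@convex_set R M) S.

Definition polyhedron (R : realType) (n : nat) (P : set 'cV[R]_n) : Prop :=
  exists (m : nat) (A : 'M[R]_(m, n)) (b : 'cV[R]_m),
    P = [set v | forall i, (A *m v) i 0 <= b i 0].

Definition affine_function (R : realType) (n : nat) (g : 'cV[R]_n -> R) :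
    Prop :=
  exists (c : 'rV[R]_n) (d : R), forall v, g v = (c *m v) 0 0 + d.

Definition affinely_independent (R : realType) (n m : nat)
    (p : 'I_m -> 'cV[R]_n) : Prop :=
  forall c : 'I_m -> R,
    \sum_i c i = 0 -> \sum_i c i *: p i = 0 -> forall i, c i = 0.

(* The largest number of affinely independent points of S, minus one (so the
   empty set has dimension -1). In an n-dimensional space there are never more
   than n + 1 affinely independent points, whence the range of the maximum. *)
Definition affine_dim (R : realType) (n : nat) (S : set 'cV[R]_n) : int :=
  (\max_(m < n.+2 | `[< exists p : 'I_m -> 'cV[R]_n,
       affinely_independent p /\ forall i, S (p i) >]) (m : nat))%N%:Z - 1.

(* The linear inequality lhs v <= rhs v is facet-defining for P; the equality
   set of a valid inequality is a face by definition. *)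
Definition facet_defining (R : realType) (n : nat) (P : set 'cV[R]_n)
    (lhs rhs : 'cV[R]_n -> R) : Prop :=
  [/\ polyhedron P,
      affine_function lhs /\ affine_function rhs,
      forall v, P v -> lhs v <= rhs v &
      affine_dim (P `&` [set v | lhs v = rhs v]) = affine_dim P - 1].

Definition X1 (R : realType) (f : R -> R) (a : R) (mu : int) : set (R * int) :=
  [set p | p.1 <= f (a * p.2%:~R) /\ 0 <= p.2 <= mu].

(* The inclusion of R x Z in R^2: row 0 is w and row 1 is x. *)
Definition embed (R : realType) (p : R * int) : 'cV[R]_2 :=
  \col_(i < 2) [:: p.1; p.2%:~R]`_i.

(* Main.v *)
Require Import Defs.
From mathcomp Require Import all_boot all_order all_algebra.
From mathcomp Require Import all_classical all_reals convex.
From mathcomp Require Import interval_inference lra zify.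

(** Put h(i) = f(ia). Concavity makes h lie below the line through any two
    consecutive points (j, h(j)), (j+1, h(j+1)), so the hull is contained in
    the polygon cut out by these mu lines and 0 <= x <= mu. Conversely, a point
    of the polygon with j <= x <= j+1 lies on the segment between suitable
    vertical translates, downwards, of (j, h(j)) and (j+1, h(j+1)). The hull
    thus has dimension 2, and it contains two distinct points of each of the
    lines. *)

Set Implicit Arguments.
Unset Strict Implicit.

Import Order.TTheory GRing.Theory Num.Theory.

Local Open Scope classical_set_scope.
Local Open Scope ring_scope.

(** * Concave sequences and their chords *)

Definition concave_seq (R : numDomainType) (h : nat -> R) : Prop :=
  forall i, h i.+2 - h i.+1 <= h i.+1 - h i.

(** The line through the points of the graph of [h] at j and j+1, anchored at its right end to match
    the inequality of the theorem with k = j+1. *)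
Definition chord (R : numDomainType) (h : nat -> R) (j : nat) (x : R) : R :=
  (h j.+1 - h j) * (x - j.+1%:R) + h j.+1.

Lemma chord_left (R : realDomainType) (h : nat -> R) (j : nat) :
  chord h j j%:R = h j.
Proof. by rewrite /chord -natr1; lra. Qed.

Lemma chord_right (R : numDomainType) (h : nat -> R) (j : nat) :
  chord h j j.+1%:R = h j.+1.
Proof. by rewrite /chord subrr mulr0 add0r. Qed.

(** Consecutive chords meet at their common node, and the later one is no steeper; so to the left of
    that node it lies above the earlier one. Induction moves the chord away from i, starting from
    the one that begins at i. *)
Lemma le_chord_left (R : realDomainType) (h : nat -> R) (i m : nat) :
  concave_seq h -> h i <= chord h (i + m) i%:R.
Proof.
move=> hc; elim: m => [|m IH]; first by rewrite addn0 chord_left.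
apply: le_trans IH _; rewrite addnS /chord.
have := hc (i + m)%N; set d := h (i + m).+1 - h (i + m)%N.
set d' := h (i + m).+2 - h (i + m).+1 => dd.
have -> : h (i + m).+2 = d' + h (i + m).+1 by rewrite /d'; lra.
rewrite -!natr1 natrD.
have m0 : 0 <= m%:R :> R := ler0n R m.
by nra.
Qed.

Lemma concave_seq_slope (R : realDomainType) (h : nat -> R) (j m : nat) :
  concave_seq h -> h (j + m).+1 - h (j + m)%N <= h j.+1 - h j.
Proof.
move=> hc; elim: m => [|m IH]; first by rewrite addn0.
by rewrite addnS; apply: le_trans (hc _) IH.
Qed.

(** To the right of j, each increment of [h] is at most the slope of the chord. *)
Lemma le_chord_right (R : realDomainType) (h : nat -> R) (j m : nat) :
  concave_seq h -> h (j + m)%N <= chord h j (j + m)%:R.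
Proof.
move=> hc; elim: m => [|m IH]; first by rewrite addn0 chord_left.
have := concave_seq_slope j m hc; move: IH.
by rewrite addnS /chord -!natr1 natrD; lra.
Qed.

Lemma le_chord (R : realDomainType) (h : nat -> R) (i j : nat) :
  concave_seq h -> h i <= chord h j i%:R.
Proof.
move=> hc; have [ij|ji] := leqP i j.
  by rewrite -(subnKC ij); apply: le_chord_left.
by rewrite -(subnKC (ltnW ji)); apply: le_chord_right.
Qed.

Lemma concave_function_seq (R : realType) (f : R -> R) (a : R) :
  @concave_function R R^o setT f -> concave_seq (fun i => f (i%:R * a)).
Proof.
move=> hf i.
(* Concavity at weight 1/2 suffices, (i+1)a being the midpoint of ia and (i+2)a. *)
have h0 : 0 <= 2^-1 :> R by lra.
have h1 : 2^-1 <= 1 :> R by lra.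
have /(_ _ _)-H := hf (Itv01 h0 h1) (i%:R * a) (i.+2%:R * a).
have : 2^-1 * f (i%:R * a) + (1 - 2^-1) * f (i.+2%:R * a)
     <= f (2^-1 * (i%:R * a) + (1 - 2^-1) * (i.+2%:R * a)).
  by apply: H; rewrite in_setT.
have -> : 2^-1 * (i%:R * a) + (1 - 2^-1) * (i.+2%:R * a) = i.+1%:R * a.
  by rewrite -[i.+2%:R]natr1 -[i.+1%:R]natr1; lra.
by lra.
Qed.

(** * Coordinates and polyhedra *)

Lemma cV2_eq (R : Type) (u v : 'M[R]_(2, 1)) :
  u 0 0 = v 0 0 -> u 1 0 = v 1 0 -> u = v.
Proof.
move=> e0 e1; apply/matrixP => i j; rewrite ord1 {j}.
case: i => [[|[|//]] lti].
  by rewrite (_ : Ordinal lti = 0)//; apply: val_inj.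
by rewrite (_ : Ordinal lti = 1)//; apply: val_inj.
Qed.

Lemma embed0 (R : realType) (p : R * int) : embed p 0 0 = p.1.
Proof. by rewrite mxE. Qed.

Lemma embed1 (R : realType) (p : R * int) : embed p 1 0 = p.2%:~R.
Proof. by rewrite mxE. Qed.

Lemma affine_function_coord (R : realType) (n : nat) (i : 'I_n) (s d : R) :
  affine_function (fun v : 'cV[R]_n => s * v i 0 + d).
Proof.
by exists (s *: delta_mx 0 i), d => v; rewrite -scalemxAl -rowE !mxE.
Qed.

(** An arbitrary finite index type allows chord inequalities and bounds on x to be indexed by a sum
    type, without numbering the rows of a matrix. *)
Lemma polyhedron_halfspaces (R : realType) (n : nat) (I : finType)
    (g : I -> 'cV[R]_n -> R) :
  (forall i, affine_function (g i)) ->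
  polyhedron [set v | forall i, g i v <= 0].
Proof.
move=> gA; have /choice[c cP] : forall i, exists cd : 'rV[R]_n * R,
    forall v, g i v = (cd.1 *m v) 0 0 + cd.2.
  by move=> i; have [c [d E]] := gA i; exists (c, d).
pose A := \matrix_(i < #|I|) (c (enum_val i)).1.
exists #|I|, A, (\col_i - (c (enum_val i)).2).
have rE v i : (A *m v) i 0 = ((c (enum_val i)).1 *m v) 0 0.
  by rewrite !mxE; apply: eq_bigr => k _; rewrite !mxE.
apply/seteqP; split => v /= H i.
  by rewrite rE [leRHS]mxE -subr_le0 opprK -cP.
have := H (enum_rank i).
by rewrite rE [leRHS]mxE enum_rankK -subr_le0 opprK -cP.
Qed.

(** * The hull as a polygon, unbounded in the direction of decreasing w *)

Definition polygon (R : numDomainType) (h : nat -> R) (n : nat) :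
    set 'cV[R]_2 :=
  [set v | 0 <= v 1 0 <= n%:R /\ forall j : 'I_n, v 0 0 <= chord h j (v 1 0)].

Lemma polyhedron_polygon (R : realType) (h : nat -> R) (n : nat) :
  polyhedron (polygon h n).
Proof.
pose g (i : 'I_n + bool) (v : 'cV[R]_2) := match i with
  | inl j => v 0 0 - chord h j (v 1 0)
  | inr true => v 1 0 - n%:R
  | inr false => - v 1 0 end.
rewrite (_ : polygon h n = [set v | forall i, g i v <= 0]).
  apply: polyhedron_halfspaces => -[j|[]].
  - exists (delta_mx 0 0 - (h j.+1 - h j) *: delta_mx 0 1).
    exists ((h j.+1 - h j) * j.+1%:R - h j.+1) => v.
    rewrite mulmxBl -scalemxAl -!rowE !mxE /g /chord; lra.
  - rewrite (_ : g _ = fun v => 1 * v 1 0 + (- n%:R)).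
      exact: affine_function_coord.
    by apply/funext => v; rewrite mul1r.
  - rewrite (_ : g _ = fun v => (-1) * v 1 0 + 0).
      exact: affine_function_coord.
    by apply/funext => v; rewrite mulN1r addr0.
apply/seteqP; split => v /=.
  move=> [/andP[x0 xn] hv] [j|[]] /=; last by lra.
    by rewrite subr_le0.
  by rewrite subr_le0.
move=> H; have := H (inr true); have := H (inr false) => /= x0 xn.
split; first by apply/andP; split; lra.
by move=> j; have := H (inl j); rewrite /= subr_le0.
Qed.

Lemma convex_polygon (R : realType) (h : nat -> R) (n : nat) :
  convex_set (polygon h n).
Proof.
move=> u v t /set_mem[/andP[u0 un] hu] /set_mem[/andP[v0 vn] hv].
apply/mem_set.
have t0 : 0 <= t%:num by [].
have t1 : t%:num <= 1 by [].
have cE i : (conv t u v) i 0 = t%:num * u i 0 + (1 - t%:num) * v i 0.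
  by rewrite !mxE.
split; first by rewrite cE; apply/andP; split; nra.
move=> j; rewrite !cE; have := hu j; have := hv j; rewrite /chord.
by set s := _ - h j; move=> A B; nra.
Qed.

Lemma convex_hull_conv (R : realType) (M : lmodType R) (S : set M) (u v : M)
    (t : R) :
  0 <= t <= 1 -> S u -> S v -> convex_hull S (t *: u + (1 - t) *: v).
Proof.
move=> /andP[t0 t1] Su Sv C [cC SC].
by have /set_mem := cC u v (Itv01 t0 t1) (mem_set (SC _ Su)) (mem_set (SC _ Sv)).
Qed.

Lemma truncn_cell (R : realType) (n : nat) (x : R) :
  0 <= x <= n.+1%:R ->
  exists j : 'I_n.+1, j%:R <= x <= j.+1%:R.
Proof.
(* At the right end the truncation of x is n+1, which indexes no cell; the last cell serves
   instead. *)
move=> /andP[x0 xn]; have [e|ne] := eqVneq x n.+1%:R.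
  by exists ord_max; rewrite e lexx ler_nat leqnSn.
have lt : (Num.truncn x < n.+1)%N by rewrite truncn_lt_nat// lt_neqAle ne.
exists (Ordinal lt) => /=.
by have /andP[-> /ltW ->] := truncn_itv x0.
Qed.

Lemma convex_hull_X1 (R : realType) (f : R -> R) (a : R) (n : nat) :
  @concave_function R R^o setT f ->
  convex_hull (@embed R @` X1 f a n.+1)
    = polygon (fun i => f (i%:R * a)) n.+1.
Proof.
move=> /(@concave_function_seq _ _ a); set h := fun i => _ => hc.
apply/seteqP; split.
  apply: smallest_sub; first exact: convex_polygon.
  move=> _ [[w [i|i]] [wf /= ile] <-] //.
  split; first by rewrite embed1 ler0n ler_nat.
  move=> j; rewrite embed0 embed1; apply: le_trans wf _.
  by rewrite mulrC; apply: le_chord.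
move=> v [vx hv]; have [j /andP[jx xj]] := truncn_cell vx.
(* [t] is the barycentric weight of j in the cell [j, j+1], and [e] the signed height of v above the
   chord. Shifting both ends of the chord by [e] puts v on the segment between them. *)
pose t : R := j.+1%:R - v 1 0.
pose e := v 0 0 - chord h j (v 1 0).
have e0 : e <= 0 by rewrite subr_le0; apply: hv.
have -> : v = t *: embed (h j + e, j%:Z)
            + (1 - t) *: embed (h j.+1 + e, j.+1%:Z).
  apply: cV2_eq; rewrite !mxE /=.
    by rewrite /e /t /chord; lra.
  by rewrite -!pmulrn /t -natr1; lra.
apply: convex_hull_conv.
- by rewrite /t; move: jx xj; rewrite -natr1 => jx xj; apply/andP; split; lra.
- exists (h j + e, j%:Z) => //; split => /=.
    by rewrite [a * _]mulrC gerDl.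
  by have := ltn_ord j; lia.
- exists (h j.+1 + e, j.+1%:Z) => //; split => /=.
    by rewrite [a * _]mulrC gerDl.
  by have := ltn_ord j; lia.
Qed.

(** * Affine dimensions *)

Lemma affine_dimE (R : realType) (n m : nat) (S : set 'cV[R]_n)
    (p : 'I_m -> 'cV[R]_n) :
  (m < n.+2)%N -> affinely_independent p -> (forall i, S (p i)) ->
  (forall l (q : 'I_l -> 'cV[R]_n), (m < l < n.+2)%N -> (forall i, S (q i)) ->
     ~ affinely_independent q) ->
  affine_dim S = m%:Z - 1.
Proof.
move=> mn pi pS H; rewrite /affine_dim; congr (Posz _ - 1).
apply/eqP; rewrite eqn_leq; apply/andP; split.
  apply/bigmax_leqP => i /asboolP[q [qi qS]]; rewrite leqNgt.
  by apply/negP => mi; apply: (H i q) => //; rewrite mi ltn_ord.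
apply: (@leq_bigmax_cond _ _ (fun i : 'I_n.+2 => nat_of_ord i) (Ordinal mn)).
by apply/asboolP; exists p.
Qed.

Lemma collinear_not_affinely_independent (R : realType) (s d : R)
    (p : 'I_3 -> 'cV[R]_2) :
  (forall i, p i 0 0 = s * p i 1 0 + d) -> ~ affinely_independent p.
Proof.
move=> pE pind.
pose i0 : 'I_3 := ord0; pose i1 : 'I_3 := lift ord0 ord0.
pose i2 : 'I_3 := lift ord0 (lift ord0 ord0).
pose x i := p i 1 0.
pose c (z0 z1 z2 : R) (i : 'I_3) := [:: z0; z1; z2]`_i.
(* A dependency among the values [x i] with coefficient sum 0 is one among the
   points, and (x1 - x2, x2 - x0, x0 - x1) is always such a dependency; so the
   [x i] coincide, and then (1, -1, 0) is another. *)
have dep z0 z1 z2 : z0 + z1 + z2 = 0 ->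
    z0 * x i0 + z1 * x i1 + z2 * x i2 = 0 -> z0 = 0 /\ z1 = 0.
  move=> e0 ex.
  have /(_ _ _)-H := pind (c z0 z1 z2).
  have {}H : forall i, c z0 z1 z2 i = 0.
    apply: H; first by rewrite !big_ord_recl big_ord0 /c /=; lra.
    rewrite !big_ord_recl big_ord0 /c /= addr0.
    apply: cV2_eq; rewrite !mxE; last by move: ex; rewrite /x /i0 /i1 /i2; lra.
    rewrite !pE -/(x i0) -/(x i1) -/(x i2).
    (* On the line, the sum of the z_i w_i is s times the sum of the z_i x_i plus d times the sum of
       the z_i, and both sums vanish. *)
    have := congr1 (fun y => s * y) ex.
    have -> : z2 = - z0 - z1 by lra.
    by lra.
  by split; [have := H i0|have := H i1].
have [] := dep (x i1 - x i2) (x i2 - x i0) (x i0 - x i1); [lra|lra|] => e1 e2.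
by have [] := dep 1 (-1) 0; lra.
Qed.

Lemma polygon_vertex (R : realType) (h : nat -> R) (n i : nat) (w : R) :
  concave_seq h -> (i <= n)%N -> w <= h i ->
  polygon h n (embed (w, i%:Z)).
Proof.
move=> hc le_in wh; split; rewrite ?embed0 embed1 ?ler0n ?ler_nat//.
by move=> j; apply: le_trans wh (le_chord _ _ hc).
Qed.

Lemma affine_dim_polygon (R : realType) (h : nat -> R) (n : nat) :
  concave_seq h -> affine_dim (polygon h n.+1) = 2.
Proof.
move=> hc.
(* Two points on the vertical line x = 0 and one off it. The x-coordinates force the third
   coefficient to vanish, then the w-coordinates the other two. *)
pose q : seq (R * int) := [:: (h 0%N, 0%:Z); (h 0%N - 1, 0%:Z); (h 1%N, 1%:Z)].
rewrite (@affine_dimE _ _ 3 _ (fun i => embed (nth (0, 0) q i)))//.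
- move=> c; rewrite !big_ord_recl !big_ord0 /= => c0 /colP cE.
  have := cE 0; have := cE 1; rewrite !mxE /= !mulr0 !addr0 !add0r mulr1.
  move=> c2; rewrite c2 mul0r addr0 => cw.
  move: c0; rewrite c2 addr0 addr0 => c01.
  have e0 : c ord0 = - c (lift ord0 ord0) by lra.
  have e1 : c (lift ord0 ord0) = 0 by move: cw; rewrite e0; lra.
  case=> [[|[|[|//]]] lti].
  + by rewrite (_ : Ordinal lti = ord0) ?e0 ?e1 ?oppr0//; apply: val_inj.
  + by rewrite (_ : Ordinal lti = lift ord0 ord0)//; apply: val_inj.
  + by rewrite (_ : Ordinal lti = lift ord0 (lift ord0 ord0))//; apply: val_inj.
- by case=> [[|[|[|//]]] lti] /=; apply: polygon_vertex => //; lra.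
(* Three is already the largest size that [affine_dim] considers in the plane. *)
- by move=> l p; lia.
Qed.

Lemma affine_dim_polygon_edge (R : realType) (h : nat -> R) (n j : nat) :
  concave_seq h -> (j < n)%N ->
  affine_dim (polygon h n `&` [set v | v 0 0 = chord h j (v 1 0)]) = 1.
Proof.
move=> hc jn.
(* The ends of the edge, independent because their x-coordinates differ. *)
pose q : seq (R * int) := [:: (h j, j%:Z); (h j.+1, j.+1%:Z)].
rewrite (@affine_dimE _ _ 2 _ (fun i => embed (nth (0, 0) q i)))//.
- move=> c; rewrite !big_ord_recl !big_ord0 /= => c0 /colP cE.
  have := cE 1; rewrite !mxE /= -!pmulrn -natr1 !addr0 => cx.
  have e0 : c ord0 = - c (lift ord0 ord0) by lra.
  have e1 : c (lift ord0 ord0) = 0 by move: cx; rewrite e0; lra.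
  case=> [[|[|//]] lti].
  + by rewrite (_ : Ordinal lti = ord0) ?e0 ?e1 ?oppr0//; apply: val_inj.
  + by rewrite (_ : Ordinal lti = lift ord0 ord0)//; apply: val_inj.
- case=> [[|[|//]] lti] /=; split; try by apply: polygon_vertex => //; lia.
  + by rewrite /= embed0 embed1 chord_left.
  + by rewrite /= embed0 embed1 chord_right.
(* The only larger size to exclude is 3, and three points of the edge are collinear. *)
- move=> l p ll pS; have e : l = 3%N by lia.
  move: p pS; rewrite {}e => p pS.
  apply: (@collinear_not_affinely_independent _
           (h j.+1 - h j) (h j.+1 - (h j.+1 - h j) * j.+1%:R)) => i.
  by have [_ /= ->] := pS i; rewrite /chord; lra.
Qed.

Unset Implicit Arguments.
Set Strict Implicit.

Theorem proposition2p3 (R : realType) (f : R -> R)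
    (hf : @concave_function R R^o setT f)
    (a : R) (ha : 0 < a) (mu : int) (hmu : 1 <= mu)
    (k : int) (hk : 1 <= k <= mu) :
  facet_defining (convex_hull (@embed R @` X1 f a mu))
    (fun v : 'cV[R]_2 => v 0 0)
    (fun v : 'cV[R]_2 =>
       (f (k%:~R * a) - f ((k - 1)%:~R * a)) * (v 1 0 - k%:~R)
       + f (k%:~R * a)).
Proof.
(* The bounds leave only mu = n+1 and k = j+1 with naturals n and j; [jn] then also reads as j <
   n+1. *)
case: mu hmu hk => [[//|n]|//] _.
case: k => [[//|j]|//] /andP[_ jn].
rewrite [_ - 1](_ : _ = j%:Z); last by lia.
have hc := concave_function_seq a hf.
rewrite convex_hull_X1//; move: hc.
set h := fun i => _ => hc.
rewrite -[fun v => _ + _]/(fun v : 'cV[R]_2 => chord h j (v 1 0)).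
split.
- exact: polyhedron_polygon.
- split.
    rewrite (_ : (fun v => _) = fun v : 'cV[R]_2 => 1 * v 0 0 + 0).
      exact: affine_function_coord.
    by apply/funext => v; rewrite mul1r addr0.
  rewrite (_ : (fun v => _) = fun v : 'cV[R]_2 =>
     (h j.+1 - h j) * v 1 0 + (h j.+1 - (h j.+1 - h j) * j.+1%:R)).
    exact: affine_function_coord.
  by apply/funext => v; rewrite /chord; lra.
- by move=> v [_ /(_ (Ordinal jn))].
- by rewrite affine_dim_polygon// affine_dim_polygon_edge.
Qed.
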